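(* Let $m$ be an odd positive integer. If there exists a $\frac{m+1}{2}\times(m+1)$ equiangular tight frame, then there exists a $\frac{m^r+1}{2}\times(m^r+1)$ equiangular tight frame for every integer $r\geq 2$.
   Context: A $d\times n$ equiangular tight frame (ETF) is a collection of $n$ unit vectors $x_1,\dots,x_n$ in $\mathbb{C}^d$ attaining the Welch bound, i.e. $\max_{i\neq j}|\langle x_i,x_j\rangle|^2=\frac{n-d}{d(n-1)}$. *)

(* Defs.v *)
From mathcomp Require Import all_boot all_order all_algebra.
From mathcomp Require Import complex reals.
Set Implicit Arguments.
Unset Strict Implicit.
Unset Printing Implicit Defensive.
Import Order.TTheory GRing.Theory Num.Theory.
Local Open Scope ring_scope.

(* The maximum of |<x_i, x_j>|^2 over ordered pairs i != j, as an element of R.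
   The default value 0 does not affect it when 2 <= n, since the terms are
   nonnegative; for n <= 1 the range is empty and the value is 0. *)
Definition max_coherence_sq (R : realType) (d n : nat)
    (x : 'I_n -> 'rV[R[i]]_d) : R :=
  \big[Num.max/0]_(p : 'I_n * 'I_n | p.1 != p.2)
     ComplexField.Normc.normc (dotmx (x p.1) (x p.2)) ^+ 2.

(* The subtractions are taken in R, so they are not truncated.  For n = 1 or
   d = 0 the denominator vanishes and the quotient is 0 by convention. *)
Definition welch_bound_sq (R : realType) (d n : nat) : R :=
  (n%:R - d%:R) / (d%:R * (n%:R - 1)).

(* Vectors of C^d are represented as row vectors over R[i], with the library's
   Hermitian inner product dotmx u v = \sum_k u_k * conj v_k.  Attaining the
   Welch bound is meaningful for 2 <= n. *)
Definition is_etf (R : realType) (d n : nat) (x : 'I_n -> 'rV[R[i]]_d) : Prop :=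
  (forall i, dotmx (x i) (x i) = 1) /\
  max_coherence_sq x = welch_bound_sq R d n.

(* Main.v *)
(** The Gram matrix of an ETF of [n = m + 1 = 2 d] vectors is [1 + S / sqrt m]
    with [S] a Hermitian conference matrix: zero diagonal, unimodular entries
    elsewhere, [S ^ 2 = m].  Conversely [(1 + S / sqrt m) / 2] is a Hermitian
    projection of trace [d], hence factors through [C^d].  Normalising the last
    row of [S] to 1 leaves a core [W] of order [m]: [W ^ 2 = m - J], [W J = 0],
    [J] being the all-ones matrix.

    As in Turyn's product of cores, a core of order [m ^ r] is a signed sum of
    the tensor words of length [r], read cyclically, tiled by [W] and [I (x) J].
    These words are read off the product of [r] copies of the 2 x 2 transfer
    matrix [[W, I], [J, 0]], with entries multiplied by the Kronecker product: if
    this product is [[a, b], [c, d]], the core is [a - d].  The sign is immaterial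
    except for the two words without [W], which must have opposite signs. *)
Require Import Defs.
From mathcomp Require Import all_boot all_order all_algebra.
From mathcomp Require Import complex reals mxtens ring.
Set Implicit Arguments.
Unset Strict Implicit.
Unset Printing Implicit Defensive.
Import Order.TTheory GRing.Theory Num.Theory.

Local Open Scope ring_scope.
Local Open Scope sesquilinear_scope.

(** * Kronecker product identities *)

Section Tensor.
Context {R : comNzRingType}.

Lemma tensmxDl m n (A B : 'M[R]_m) (D : 'M_n) : (A + B) *t D = A *t D + B *t D.
Proof. by apply/matrixP => i j; rewrite !mxE mulrDl. Qed.

Lemma tensmxDr m n (A : 'M[R]_m) (B D : 'M_n) : A *t (B + D) = A *t B + A *t D.
Proof. by apply/matrixP => i j; rewrite !mxE mulrDr. Qed.

Lemma tensmxNl m n (A : 'M[R]_m) (B : 'M_n) : (- A) *t B = - (A *t B).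
Proof. by apply/matrixP => i j; rewrite !mxE mulNr. Qed.

Lemma tensmxNr m n (A : 'M[R]_m) (B : 'M_n) : A *t (- B) = - (A *t B).
Proof. by apply/matrixP => i j; rewrite !mxE mulrN. Qed.

Lemma tensmxZl m n k (A : 'M[R]_m) (B : 'M_n) : (k *: A) *t B = k *: (A *t B).
Proof. by apply/matrixP => i j; rewrite !mxE mulrA. Qed.

Lemma tensmxZr m n k (A : 'M[R]_m) (B : 'M_n) : A *t (k *: B) = k *: (A *t B).
Proof. by apply/matrixP => i j; rewrite !mxE mulrCA. Qed.

Lemma tensmx11 m n : 1%:M *t 1%:M = 1%:M :> 'M[R]_(m * n).
Proof.
apply/matrixP => i' j'.
case: (mxtens_indexP i') => i k; case: (mxtens_indexP j') => j l.
rewrite !(mxE, mxtens_indexK).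
by rewrite (can_eq (@mxtens_indexK _ _)) xpair_eqE -mulnb natrM.
Qed.

Lemma tensmx_const1 m n :
  const_mx 1 *t const_mx 1 = const_mx 1 :> 'M[R]_(m * n).
Proof.
by apply/matrixP => i j; rewrite !mxE mulr1.
Qed.

Lemma mulmx_const1 m :
  (const_mx 1 : 'M[R]_m) *m const_mx 1 = m%:R *: const_mx 1 :> 'M_m.
Proof.
apply/matrixP => i j; rewrite !mxE (eq_bigr (fun=> 1)) => [|k _].
  by rewrite sumr_const card_ord mulr1.
by rewrite !mxE mulr1.
Qed.

End Tensor.

Section Core.
Context {C : numClosedFieldType}.

(** * Hermitian matrices and adjoints *)

Lemma hermitian_tensmx m n (A : 'M[C]_m) (B : 'M[C]_n) :
  A^t* = A -> B^t* = B -> (A *t B)^t* = A *t B.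
Proof. by move=> hA hB; rewrite trmx_tens map_mxT hA hB. Qed.

Lemma hermitianD n (A B : 'M[C]_n) : A^t* = A -> B^t* = B -> (A + B)^t* = A + B.
Proof. by move=> hA hB; rewrite linearD map_mxD hA hB. Qed.

Lemma adjmx_nnegZ m n (k : C) (A : 'M[C]_(m, n)) :
  0 <= k -> (k *: A)^t* = k *: A^t*.
Proof.
by move=> k0; apply/matrixP => i j; rewrite !mxE rmorphM /= geC0_conj.
Qed.

Lemma hermitian1 n : 1%:M^t* = 1%:M :> 'M[C]_n.
Proof. by rewrite trmx1 map_mx1. Qed.

Lemma hermitian_const1 n : (const_mx 1)^t* = const_mx 1 :> 'M[C]_n.
Proof. by rewrite trmx_const map_const_mx rmorph1. Qed.

Lemma hermitian_mul0C n (A B : 'M[C]_n) :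
  A^t* = A -> B^t* = B -> A *m B = 0 -> B *m A = 0.
Proof.
by move=> hA hB AB0; rewrite -hA -hB -map_mxM -trmx_mul AB0 trmx0 map_mx0.
Qed.

(** The diagonal entries of [A *m A^t*] are the squared norms of the rows of [A]. *)
Lemma mulmx_adj_eq0 m n (A : 'M[C]_(m, n)) : A *m A^t* = 0 -> A = 0.
Proof.
move=> /matrixP A0; apply/matrixP => i j; apply/eqP; rewrite mxE -mul_conjC_eq0.
have /eqP := A0 i i; rewrite !mxE psumr_eq0 => [/allP/(_ j)|k _].
  by rewrite mem_index_enum !mxE; apply.
by rewrite !mxE mul_conjC_ge0.
Qed.

(** * Cores and their tensor powers *)

Record core m (W : 'M[C]_m) : Prop := Core {
  core_hermitian : W^t* = W;
  core_diag : forall i, W i i = 0;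
  core_norm : forall i j, i != j -> `|W i j| = 1;
  core_sum : W *m const_mx 1 = 0 :> 'M_m;
  core_sqr : W *m W = m%:R%:M - const_mx 1 }.

Lemma core_const1 m (W : 'M[C]_m) : core W -> const_mx 1 *m W = 0 :> 'M_m.
Proof.
move=> cW; apply: hermitian_mul0C (core_sum cW) => //.
  exact: core_hermitian cW.
exact: hermitian_const1.
Qed.

(* The invariants of the product [[a, b], [c, d]] of r copies of [[W, I], [J, 0]],
   where n = m ^ r and e is the parity of r (true when r is even).  Entries
   depend only on which of the r indices of i and j agree: an agreement swaps the
   two rows, and a single disagreement makes the 2 x 2 matrix of entries rank 1,
   with one zero column. *)
Record transfer (m n : nat) (e : bool) (a b c d : 'M[C]_n) : Prop := Transfer {
  tr_herm : [/\ a^t* = a, b^t* = b, c^t* = c & d^t* = d];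
  tr_diag : forall i, [/\ a i i = e%:R, b i i = (~~ e)%:R,
                          c i i = (~~ e)%:R & d i i = e%:R];
  tr_norm : forall i j, i != j ->
    [/\ `|a i j| = 1, `|c i j| = 1, b i j = 0 & d i j = 0] \/
    [/\ `|b i j| = 1, `|d i j| = 1, a i j = 0 & c i j = 0];
  tr_ac0 : a *m c = 0 /\ c *m a = 0;
  tr_bd0 : b *m d = 0 /\ d *m b = 0;
  tr_ad : a *m d = e%:R *: const_mx 1 /\ d *m a = e%:R *: const_mx 1;
  tr_bc : b *m c = (~~ e)%:R *: const_mx 1 /\ c *m b = (~~ e)%:R *: const_mx 1;
  tr_sqr_ac : m%:R *: (a *m a) + c *m c = (m * n)%:R%:M;
  tr_sqr_bd : m%:R *: (b *m b) + d *m d = n%:R%:M;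
  tr_sqr_ad : a *m a + d *m d = n%:R%:M + (2 * e%:R - 1) *: const_mx 1 }.

Lemma transfer0 m : transfer m true 1%:M 0 0 (1%:M : 'M[C]_1).
Proof.
split; rewrite ?(mul1mx, mulmx1, mulmx0, mul0mx, scaler0, muln1, add0r, addr0,
                 scale1r, scale0r) //.
- by rewrite hermitian1 trmx0 map_mx0.
- by move=> i; rewrite !mxE eqxx.
- by move=> i j; rewrite !ord1 eqxx.
- by split; apply/matrixP => i j; rewrite !ord1 !mxE.
- by rewrite scalemx1.
- apply/matrixP => i j; rewrite !ord1 !mxE eqxx /=; ring.
Qed.

(** One more transfer matrix is multiplied on the left. Mixed products of the new rows lose their
    [W] term because W J = J W = 0. In the weighted squares the -J coming from W ^ 2 = m - J cancels
    against J ^ 2 = m J. *)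
Lemma transferS m n e (W : 'M[C]_m) (a b c d : 'M[C]_n) :
  core W -> transfer m e a b c d ->
  transfer m (~~ e) (W *t a + 1%:M *t c) (W *t b + 1%:M *t d)
    (const_mx 1 *t a) (const_mx 1 *t b).
Proof.
move=> cW [[ha hb hc hd] dg nrm [ac ca] [bd db] [ad da] [bc cb] sac sbd sad].
have WJ := core_sum cW; have JW := core_const1 cW; have WW := core_sqr cW.
(* The anticommutator next to [W] vanishes in each use below, where x, y are [a], [c] or [b],
   [d]. *)
have eW (x y : 'M[C]_n) : (W *t x + 1%:M *t y) *m (W *t x + 1%:M *t y) =
   1%:M *t (m%:R *: (x *m x) + y *m y) - const_mx 1 *t (x *m x)
   + W *t (x *m y + y *m x).
  rewrite mulmxDl !mulmxDr !tensmx_mul !(mulmx1, mul1mx) WW -scalemx1.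
  rewrite !(tensmxDl, tensmxDr, tensmxNl, tensmxZl, tensmxZr).
  by apply/matrixP => i j; rewrite !mxE; ring.
have eJ (x y : 'M[C]_n) :
   ((const_mx 1 : 'M[C]_m) *t x) *m ((const_mx 1 : 'M_m) *t y) =
   m%:R *: ((const_mx 1 : 'M_m) *t (x *m y)).
  by rewrite tensmx_mul mulmx_const1 tensmxZl.
have eWJ (x y z : 'M[C]_n) :
   (W *t x + 1%:M *t y) *m ((const_mx 1 : 'M_m) *t z) =
   (const_mx 1 : 'M_m) *t (y *m z).
  by rewrite mulmxDl !tensmx_mul WJ tens0mx add0r mul1mx.
have eJW (x y z : 'M[C]_n) :
   ((const_mx 1 : 'M_m) *t z) *m (W *t x + 1%:M *t y) =
   (const_mx 1 : 'M_m) *t (z *m y).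
  by rewrite mulmxDr !tensmx_mul JW tens0mx add0r mulmx1.
have eI k : 1%:M *t k%:M = k%:M :> 'M[C]_(m * n).
  by rewrite -(scalemx1 _ k) tensmxZr tensmx11 scalemx1.
split.
- by split;
    rewrite ?hermitianD ?hermitian_tensmx ?hermitian1 ?hermitian_const1 ?(core_hermitian cW).
- move=> i; case: (mxtens_indexP i) => k l.
  rewrite !(mxE, mxtens_indexK) (core_diag cW) !mul0r !add0r eqxx !mul1r.
  by have [-> -> -> ->] := dg l; rewrite negbK.
- move=> i j; case: (mxtens_indexP i) => i1 i2; case: (mxtens_indexP j) => j1 j2.
  rewrite (can_eq (@mxtens_indexK _ _)) xpair_eqE negb_and.
  rewrite !(mxE, mxtens_indexK) !mul1r.
  have [->/=|ij1 _] := eqVneq i1 j1.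
    rewrite (core_diag cW) !mul0r !add0r !mul1r => /nrm[] [-> -> -> ->]; by [left|right].
  rewrite !mul0r !addr0.
  have nW := core_norm cW ij1.
  (* The first indices disagree, so both new rows come from [a] and [b], up to the unimodular
     [W i1 j1]. If the second indices agree, exactly one of [a], [b] has entry 1 there, according to
     the parity [e]. *)
  have [->|/nrm[] [na nc nb nd]] := eqVneq i2 j2.
  + have [-> -> _ _] := dg j2.
    by case: (e); rewrite /= !(mulr0, mulr1, normr1); [left|right].
  + by left; rewrite nb normrM nW na mulr0 mul1r.
  + by right; rewrite nb normrM nW na mulr0 mul1r.
- by rewrite eWJ eJW ac ca tensmx0.
- by rewrite eWJ eJW bd db tensmx0.
- by rewrite eWJ eJW bc cb tensmxZr tensmx_const1.
- by rewrite eWJ eJW ad da tensmxZr tensmx_const1 negbK.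
- rewrite eW eJ sac ac ca addr0 tensmx0 addr0 eI scalerDr scalerN subrK.
  by rewrite !natrM scale_scalar_mx.
- rewrite eW eJ sbd bd db addr0 tensmx0 addr0 eI scalerDr scalerN subrK.
  by rewrite natrM scale_scalar_mx.
(* Eliminating d ^ 2 between two invariants makes the J (x) a ^ 2 terms cancel; what is left is J
   with the sign reversed, as the change of parity requires. *)
have sab : m%:R *: (b *m b) = a *m a - (2 * e%:R - 1) *: const_mx 1.
  by apply: (addIr (d *m d)); rewrite sbd addrAC sad addrK.
rewrite eW eJ sac ac ca addr0 tensmx0 addr0 eI -tensmxZr sab tensmxDr tensmxNr.
rewrite tensmxZr tensmx_const1 addrA subrK -scaleNr; congr (_ + _ *: _).
by case: (e) => /=; ring.
Qed.

(** Since a d = d a = e J, expanding (a - d) ^ 2 turns (2 e - 1) J into -J for either parity. *)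
Lemma core_of_transfer m n e (a b c d : 'M[C]_n) :
  transfer m e a b c d -> core (a - d).
Proof.
move=> [[ha hb hc hd] dg nrm [ac ca] [bd db] [ad da] [bc cb] sac sbd sad].
have hK : (a - d)^t* = a - d by rewrite linearB map_mxB ha hd.
have KK : (a - d) *m (a - d) = n%:R%:M - const_mx 1.
  rewrite mulmxBl !mulmxBr ad da opprB addrA [_ - _ + _]addrAC sad.
  by apply/matrixP => i j; rewrite !mxE; ring.
split => //.
- by move=> i; rewrite !mxE; have [-> _ _ ->] := dg i; rewrite subrr.
- by move=> i j /nrm[] [na nc nb nd]; rewrite !mxE ?nd ?nb ?subr0 // sub0r normrN.
(* With K = a - d, the matrix J K vanishes because (J K)(J K)^* = J (n - J) J = 0, by J ^ 2 = n
   J. *)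
apply: hermitian_mul0C => //; first exact: hermitian_const1.
apply: mulmx_adj_eq0; rewrite trmx_mul map_mxM hK hermitian_const1 mulmxA.
rewrite -(mulmxA (const_mx 1) (a - d) (a - d)) KK mulmxBr.
by rewrite mul_mx_scalar mulmx_const1 subrr mul0mx.
Qed.

Lemma core_exp m r (W : 'M[C]_m) :
  core W -> exists K : 'M[C]_(m ^ r), core K.
Proof.
move=> cW; suff [e [a [b [c [d /core_of_transfer ?]]]]] :
  exists e (a b c d : 'M[C]_(m ^ r)), transfer m e a b c d by exists (a - d).
elim: r => [|r [e [a [b [c [d tr]]]]]].
  by do 5 eexists; exact: transfer0.
rewrite expnS; do 5 eexists; exact: transferS cW tr.
Qed.


(** * Passing between conference matrices and cores *)

Record conference m (S : 'M[C]_(m + 1)) : Prop := Conference {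
  conf_hermitian : S^t* = S;
  conf_diag : forall i, S i i = 0;
  conf_norm : forall i j, i != j -> `|S i j| = 1;
  conf_sqr : S *m S = m%:R%:M }.

Lemma hermitian_entry n (A : 'M[C]_n) i j : A^t* = A -> A j i = (A i j)^*.
Proof. by move=> hA; rewrite -{1}hA !mxE. Qed.

(** Conjugating [S] by the unimodular diagonal matrix of the entries [S o i] makes its last row and
    column 1 off the diagonal; deleting them leaves the core. The deleted column accounts for the -J
    in W ^ 2. *)
Lemma core_of_conference m (S : 'M[C]_(m + 1)) :
  conference S -> exists W : 'M[C]_m, core W.
Proof.
move=> [hS dS nS SS]; pose o : 'I_(m + 1) := rshift m ord0.
have oD i : lshift 1 i != o by rewrite eq_lrshift.
have So i : S (lshift 1 i) o * S o (lshift 1 i) = 1.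
  by rewrite (hermitian_entry (lshift 1 i) o hS) -normCK nS // expr1n.
have eS i k : \sum_j S i (lshift 1 j) * S (lshift 1 j) k =
    m%:R *+ (i == k) - S i o * S o k.
  have /matrixP/(_ i k) := SS.
  by rewrite !mxE big_split_ord big_ord1 => <-; rewrite addrK.
exists (\matrix_(i, j)
  (S o (lshift 1 i) * S (lshift 1 i) (lshift 1 j) * S (lshift 1 j) o)).
split.
- apply/matrixP => i j; rewrite !mxE !rmorphM /= -!(hermitian_entry _ _ hS).
  by ring.
- by move=> i; rewrite mxE dS mulr0 mul0r.
- move=> i j ij; rewrite mxE !normrM (nS o) 1?eq_sym // (nS _ o) //.
  by rewrite nS ?eq_lshift // !mulr1.
- apply/matrixP => i j; rewrite !mxE.
  under eq_bigr => k _ do rewrite !mxE mulr1 -mulrA.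
  by rewrite -mulr_sumr eS dS (negbTE (oD i)) mulr0 subrr mulr0.
apply/matrixP => i k; rewrite !mxE.
under eq_bigr => j _.
  rewrite !mxE.
  have -> : S o (lshift 1 i) * S (lshift 1 i) (lshift 1 j) * S (lshift 1 j) o *
    (S o (lshift 1 j) * S (lshift 1 j) (lshift 1 k) * S (lshift 1 k) o) =
    S o (lshift 1 i) * S (lshift 1 k) o *
    (S (lshift 1 i) (lshift 1 j) * S (lshift 1 j) (lshift 1 k)) *
    (S (lshift 1 j) o * S o (lshift 1 j)) by ring.
  rewrite So mulr1; over.
rewrite -mulr_sumr eS eq_lshift.
have -> : S o (lshift 1 i) * S (lshift 1 k) o *
   (m%:R *+ (i == k) - S (lshift 1 i) o * S o (lshift 1 k)) =
   (S (lshift 1 k) o * S o (lshift 1 i)) * (m%:R *+ (i == k)) -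
   (S (lshift 1 i) o * S o (lshift 1 i)) * (S (lshift 1 k) o * S o (lshift 1 k)) by ring.
by rewrite !So mulr1; case: eqVneq => [->|_]; rewrite ?So ?mul1r ?mulr0.
Qed.

Lemma conference_of_core m (K : 'M[C]_m) :
  core K -> exists S : 'M[C]_(m + 1), conference S.
Proof.
move=> cK.
have K1 : K *m const_mx 1 = 0 :> 'cV_m.
  apply/matrixP => i j; have /matrixP/(_ i i) := core_sum cK.
  rewrite !mxE => K0; rewrite -[RHS]K0.
  by apply: eq_bigr => k _; rewrite !mxE.
have K1r : const_mx 1 *m K = 0 :> 'rV_m.
  apply/matrixP => i j; have /matrixP/(_ j j) := core_const1 cK.
  rewrite !mxE => K0; rewrite -[RHS]K0.
  by apply: eq_bigr => k _; rewrite !mxE.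
exists (block_mx K (const_mx 1) (const_mx 1) 0); split.
- rewrite tr_block_mx map_block_mx (core_hermitian cK).
  by rewrite !trmx_const !map_const_mx rmorph1 rmorph0.
- move=> i; case: (split_ordP i) => k ->.
    by rewrite block_mxEul (core_diag cK).
  by rewrite block_mxEdr mxE.
- move=> i j; case: (split_ordP i) => i1 ->; case: (split_ordP j) => j1 ->.
  + by rewrite eq_lshift block_mxEul; apply: core_norm.
  + by rewrite block_mxEur mxE normr1.
  + by rewrite block_mxEdl mxE normr1.
  + by rewrite !ord1 eqxx.
rewrite mulmx_block scalar_mx_block K1 K1r (core_sqr cK) !mulmx0 !mul0mx !addr0.
congr block_mx.
  by apply/matrixP => i j; rewrite !mxE big_ord1 !mxE mulr1 subrK.
apply/matrixP => i j; rewrite !mxE (eq_bigr (fun=> 1)) => [|k _].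
  by rewrite sumr_const card_ord !ord1 eqxx.
by rewrite !mxE mulr1.
Qed.

(** * Passing between Gram matrices and conference matrices *)

Lemma mxtrace_mul_adj m n (A : 'M[C]_(m, n)) :
  \tr (A *m A^t*) = \sum_p `|A p.1 p.2| ^+ 2.
Proof.
rewrite -(pair_bigA _ (fun i j => `|A i j| ^+ 2)); apply: eq_bigr => i _.
by rewrite mxE; apply: eq_bigr => j _; rewrite !mxE normCK.
Qed.

(** Equality in the Welch bound forces tightness, [X^t* *m X = 2%:M], so the Gram matrix satisfies G
    ^ 2 = 2 G and G - 1 squares to 1. *)
Lemma conference_of_gram m d (X : 'M[C]_(m + 1, d)) :
  (0 < m)%N -> (m + 1 = d.*2)%N ->
  (forall i, (X *m X^t*) i i = 1) ->
  (forall i j, i != j -> `|(X *m X^t*) i j| ^+ 2 <= m%:R^-1) ->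
  exists S : 'M[C]_(m + 1), conference S.
Proof.
move=> m_gt0 md G1 Gle; set G := X *m X^t* in G1 Gle.
have m0 : m%:R != 0 :> C by rewrite pnatr_eq0 -lt0n.
have hG : G^t* = G by rewrite trmx_mul map_mxM trmxCK.
pose D := X^t* *m X - 2%:M.
have hD : D^t* = D.
  rewrite /D linearB map_mxB /= trmx_mul map_mxM trmxCK tr_scalar_mx.
  by rewrite map_scalar_mx rmorph_nat.
have trG : \tr G = (m + 1)%:R.
  by rewrite /mxtrace (eq_bigr (fun=> 1)) ?sumr_const ?card_ord.
(* As \tr (G ^ 2) <= 2 (m + 1), the nonnegative \tr (D ^ 2) must vanish: this is
   the equality case of the Welch bound. *)
have trD : \tr (D *m D^t*) = \tr (G *m G^t*) - (2 * (m + 1))%:R.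
  rewrite hD hG mulmxBl !mulmxBr !raddfB /= !mul_mx_scalar !mul_scalar_mx !linearZ /=.
  rewrite mxtrace_scalar [\tr (X^t* *m X)]mxtrace_mulC trG mulmxA mxtrace_mulC !mulmxA.
  rewrite -/G -mulmxA -/G.
  have -> : (2 *+ d : C) = (m + 1)%:R by rewrite md -mul2n natrM mulr_natr.
  by rewrite natrM; ring.
(* [B] bounds the squared moduli of the entries of [G]; each of its rows sums to 1 + m / m = 2. *)
pose B (p : 'I_(m + 1) * 'I_(m + 1)) : C := if p.1 == p.2 then 1 else m%:R^-1.
have sB : \sum_p B p = (2 * (m + 1))%:R.
  rewrite -(pair_bigA _ (fun i j => B (i, j))) /=.
  under eq_bigr => i _.
    rewrite (bigD1 i) //= {1}/B eqxx (eq_bigr (fun=> m%:R^-1)); last first.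
      by move=> j ji; rewrite /B /= eq_sym (negbTE ji).
    rewrite sumr_const cardC1 card_ord addn1 /= -[_ *+ m]mulr_natr mulVf //; over.
  by rewrite sumr_const card_ord natrM mulr_natr.
have BG p : 0 <= B p - `|G p.1 p.2| ^+ 2.
  rewrite subr_ge0 /B; case: eqVneq => [->|]; last exact: Gle.
  by rewrite G1 normr1 expr1n.
(* A nonnegative trace equals minus a nonnegative sum, so both vanish: one gives D = 0, the other
   equiangularity. *)
have trDN : \tr (D *m D^t*) = - \sum_p (B p - `|G p.1 p.2| ^+ 2).
  by rewrite trD sumrB sB mxtrace_mul_adj opprB.
have DD0 : \sum_p `|D p.1 p.2| ^+ 2 = 0.
  apply/eqP; rewrite eq_le sumr_ge0 ?andbT => [|p _]; last by rewrite exprn_ge0.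
  by rewrite -mxtrace_mul_adj trDN oppr_le0 sumr_ge0.
have GB0 : \sum_p (B p - `|G p.1 p.2| ^+ 2) = 0.
  by apply: oppr_inj; rewrite -trDN mxtrace_mul_adj DD0 oppr0.
have D0 : D = 0.
  apply/matrixP => i j; have /eqP := DD0.
  rewrite psumr_eq0 => [|p _]; last by rewrite exprn_ge0.
  move=> /allP/(_ (i, j)); rewrite mem_index_enum => /(_ isT) /=.
  by rewrite expf_eq0 normr_eq0 => /eqP ->; rewrite mxE.
have GG : G *m G = 2 *: G.
  have /eqP := D0; rewrite subr_eq0 => /eqP XX.
  by rewrite /G mulmxA -(mulmxA X) XX mul_mx_scalar -scalemxAl.
have Gn i j : i != j -> `|G i j| ^+ 2 = m%:R^-1.
  move=> ij; have /eqP := GB0; rewrite psumr_eq0 // => /allP/(_ (i, j)).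
  by rewrite mem_index_enum => /(_ isT) /=; rewrite /B (negbTE ij) subr_eq0 => /eqP.
have rm : sqrtC m%:R ^+ 2 = m%:R :> C by rewrite sqrtCK.
have rm0 : 0 <= sqrtC m%:R :> C by rewrite sqrtC_ge0 ler0n.
exists (sqrtC m%:R *: (G - 1%:M)); split.
- by rewrite adjmx_nnegZ // linearB map_mxB /= hG hermitian1.
- by move=> i; rewrite mxE [(G - _) i i]mxE G1 !mxE eqxx subrr mulr0.
- move=> i j ij; rewrite mxE [(G - _) i j]mxE [(- 1%:M) i j]mxE [1%:M i j]mxE.
  rewrite (negbTE ij) subr0 normrM ger0_norm //.
  apply: (@pexpIrn _ 2) => //; rewrite ?nnegrE ?mulr_ge0 //.
  by rewrite exprMn rm Gn // mulfV // expr1n.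
rewrite -scalemxAl -scalemxAr scalerA -expr2 rm mulmxBl !mulmxBr GG !(mul1mx, mulmx1).
by rewrite [2]mulr2n scalerDl scale1r addrK opprB addrCA subrr addr0 scalemx1.
Qed.

(** The rows of [B] are an orthonormal basis of the row space of [P]; their number, the rank, is the
    trace of the projection. *)
Lemma projection_factor n d (P : 'M[C]_n) :
  P^t* = P -> P *m P = P -> \tr P = d%:R ->
  exists2 B : 'M[C]_(d, n), B *m B^t* = 1%:M & B^t* *m B = P.
Proof.
move=> hP PP trP; set r := \rank P.
pose B := schmidt (row_base P).
have uB : B *m B^t* = 1%:M by apply/unitarymxP/schmidt_unitarymx/rank_leq_col.
have eB : (B :=: P)%MS.
  by apply: eqmx_trans (eq_row_base P); apply/eqmx_schmidt_free/row_base_free.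
have BP : B *m P = B.
  have /submxP[E ->] : (B <= P)%MS by rewrite eB.
  by rewrite -mulmxA PP.
have PB : B^t* *m B = P.
  have /submxP[E eP] : (P <= B)%MS by rewrite eB.
  have PBt : P *m B^t* = B^t* by rewrite -{2}BP trmx_mul map_mxM hP.
  have EE : E = B^t*.
    by have := congr1 (mulmx^~ (B^t* )) eP; rewrite /= PBt -mulmxA uB mulmx1.
  by rewrite -EE -eP.
have dr : r = d.
  by apply/eqP; rewrite -(eqr_nat C) -trP -PB mxtrace_mulC uB mxtrace1.
(* [B] has [r] rows; eliminating [dr] transports it to [d] rows. *)
by case: _ / dr; exists B.
Qed.

(** As S / sqrt m squares to 1, G / 2 is a projection; its trace is (m + 1) / 2 = d because [S] has
    zero diagonal. *)
Lemma gram_of_conference m d (S : 'M[C]_(m + 1)) :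
  (0 < m)%N -> (m + 1 = d.*2)%N -> conference S ->
  exists X : 'M[C]_(m + 1, d), X *m X^t* = 1%:M + (sqrtC m%:R)^-1 *: S.
Proof.
move=> m_gt0 md [hS dS nS SS].
set G := 1%:M + _.
have m0 : m%:R != 0 :> C by rewrite pnatr_eq0 -lt0n.
have rm0 : 0 <= sqrtC m%:R :> C by rewrite sqrtC_ge0 ler0n.
have hG : G^t* = G.
  by rewrite hermitianD ?hermitian1 // adjmx_nnegZ ?invr_ge0 ?hS.
have GG : G *m G = 2 *: G.
  rewrite mulmxDl !mulmxDr !mul1mx mulmx1 -scalemxAl -scalemxAr SS scalerA.
  rewrite -invfM -expr2 sqrtCK scale_scalar_mx mulVf //.
  by rewrite [2]mulr2n scalerDl scale1r [_ *: S + _]addrC.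
have [||| B BB BG] := @projection_factor _ d (2^-1 *: G).
- by rewrite adjmx_nnegZ ?invr_ge0 ?ler0n // hG.
- by rewrite -scalemxAl -scalemxAr GG !scalerA -mulrA mulVf ?mulr1 // pnatr_eq0.
- rewrite mxtraceZ raddfD /= mxtrace1 mxtraceZ /mxtrace big1 // mulr0 addr0.
  by rewrite md -mul2n natrM mulrA mulVf ?mul1r // pnatr_eq0.
exists (sqrtC 2 *: B^t*).
rewrite adjmx_nnegZ ?sqrtC_ge0 ?ler0n // trmxCK.
rewrite -scalemxAl -scalemxAr scalerA -expr2 sqrtCK BG scalerA mulfV ?scale1r //.
by rewrite pnatr_eq0.
Qed.

End Core.

(** * Equiangular tight frames and the Welch bound *)

Section Frames.
Context {R : realType}.

Lemma welch_bound_sq_half m d :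
  (0 < m)%N -> (m + 1 = d.*2)%N -> welch_bound_sq R d (m + 1) = m%:R^-1.
Proof.
move=> m_gt0 md; rewrite /welch_bound_sq md -addnn natrD addrK.
have -> : d%:R + d%:R - 1 = m%:R :> R by rewrite -natrD addnn -md natrD addrK.
have d0 : d%:R != 0 :> R by rewrite pnatr_eq0 -double_eq0 -md addn1.
by rewrite invfM mulrA mulfV // mul1r.
Qed.

Lemma gram_entry n d (X : 'M[R[i]]_(n, d)) i j :
  (X *m X^t*) i j = dotmx (row i X) (row j X).
Proof. by rewrite dotmxE !mxE; apply: eq_bigr => k _; rewrite !mxE. Qed.

Lemma normc_sqrE (z : R[i]) :
  `|z| ^+ 2 = (ComplexField.Normc.normc z ^+ 2)%:C%C.
Proof. by rewrite rmorphXn. Qed.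

Lemma etf_conference m d (x : 'I_(m + 1) -> 'rV[R[i]]_d) :
  (0 < m)%N -> (m + 1 = d.*2)%N -> is_etf x ->
  exists S : 'M[R[i]]_(m + 1), conference S.
Proof.
move=> m_gt0 md [x1 xW].
have gram i j : ((\matrix_i x i) *m (\matrix_i x i)^t*) i j = dotmx (x i) (x j).
  by rewrite gram_entry !rowK.
apply: (@conference_of_gram _ m d (\matrix_i x i)) => // [i|i j ij].
  by rewrite gram.
rewrite gram normc_sqrE -[m%:R](rmorph_nat (real_complex R)) -fmorphV lecR.
rewrite -(welch_bound_sq_half m_gt0 md) -xW.
exact: (@le_bigmax_cond _ _ _ 0 (i, j)).
Qed.

Lemma conference_etf m d (S : 'M[R[i]]_(m + 1)) :
  (0 < m)%N -> (m + 1 = d.*2)%N -> conference S ->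
  exists x : 'I_(m + 1) -> 'rV[R[i]]_d, is_etf x.
Proof.
move=> m_gt0 md cS; have [X XX] := gram_of_conference m_gt0 md cS.
have gram i j :
    dotmx (row i X) (row j X) = (i == j)%:R + (sqrtC m%:R)^-1 * S i j.
  by rewrite -gram_entry XX !mxE.
exists (fun i => row i X); split=> [i|].
  by rewrite gram eqxx (conf_diag cS) mulr0 addr0.
have normG i j : i != j ->
    ComplexField.Normc.normc (dotmx (row i X) (row j X)) ^+ 2 = m%:R^-1.
  move=> ij; apply: (fmorph_inj (real_complex R)); rewrite /= -normc_sqrE gram.
  rewrite (negbTE ij) add0r normrM (conf_norm cS ij) mulr1 normfV.
  by rewrite ger0_norm ?sqrtC_ge0 ?ler0n // exprVn sqrtCK fmorphV rmorph_nat.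
rewrite (welch_bound_sq_half m_gt0 md); apply/le_anti/andP; split.
  (* The default value 0 of the maximum must also lie below 1 / m. *)
  by apply: bigmax_le => [|p /normG -> //]; rewrite invr_ge0 ler0n.
(* As m > 0, there is a pair of distinct indices, and the maximum is attained at it. *)
have oD : lshift 1 (Ordinal m_gt0) != rshift m ord0 by rewrite eq_lrshift.
rewrite -(normG _ _ oD).
exact: (@le_bigmax_cond _ _ _ 0 (lshift 1 (Ordinal m_gt0), rshift m ord0)).
Qed.

End Frames.

Theorem theorem5 (R : realType) (m : nat) (m_gt0 : (0 < m)%N) (m_odd : odd m) :
  (exists x : 'I_(m + 1) -> 'rV[R[i]]_((m + 1) %/ 2), is_etf x) ->
  forall r : nat, (2 <= r)%N ->
    exists y : 'I_(m ^ r + 1) -> 'rV[R[i]]_((m ^ r + 1) %/ 2), is_etf y.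
Proof.
(* Oddness of m, and hence of its powers, makes the integer division exact. *)
have half k : odd k -> (k + 1 = ((k + 1) %/ 2).*2)%N.
  by move=> k_odd; rewrite -muln2 divnK // dvdn2 addn1 /= k_odd.
move=> [x /(etf_conference m_gt0 (half _ m_odd))[S /core_of_conference[W cW]]] r _.
have [K /conference_of_core[T cT]] := core_exp r cW.
apply: conference_etf cT; first by rewrite expn_gt0 m_gt0.
by apply: half; rewrite oddX m_odd orbT.
Qed.
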